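(* Let $G$ be a bipartite multigraph (multiple edges allowed, no loops) with maximum degree $\Delta(G)$, let $k\ge 1$ be an integer, and let the palette be $\mathcal{K}=\{1,\dots,\Delta(G)+k\}$. Let $S\subseteq E(G)$ carry a proper edge-colouring with colours from $\mathcal{K}$ such that every vertex of $G$ is incident with at most $k$ edges of $S$. Then this precolouring can be extended to a proper edge-colouring of all of $G$ using only colours from $\mathcal{K}$.
   Context: A proper edge-colouring assigns colours to edges so that any two edges sharing an end-vertex (including parallel edges) receive distinct colours. Extending a precolouring means producing a proper edge-colouring of all of $G$ agreeing with the given colours on $S$. *)

(* Defs.v *)
From HB Require Import structures.
From mathcomp Require Import all_boot.

Set Implicit Arguments.
Unset Strict Implicit.
Unset Printing Implicit Defensive.

(* Finite loopless multigraphs: edges form a type of their own, so parallel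
   edges are distinct edges with the same two-element set of ends. *)
Record multigraph := Multigraph {
  vertex : finType;
  edge : finType;
  ends : edge -> {set vertex};
  card_ends : forall e, #|ends e| = 2
}.

Definition incident_edges (G : multigraph) (v : vertex G) : {set edge G} :=
  [set e | v \in ends e].

Definition degree (G : multigraph) (v : vertex G) : nat :=
  #|incident_edges v|.

Definition max_degree (G : multigraph) : nat :=
  \max_(v : vertex G) degree v.

Definition bipartite (G : multigraph) : Prop :=
  exists A : {set vertex G}, forall e : edge G,
    #|ends e :&: A| = 1 /\ #|ends e :&: ~: A| = 1.

Definition adjacent_edges (G : multigraph) (e f : edge G) : Prop :=
  e <> f /\ exists v : vertex G, v \in ends e /\ v \in ends f.

(* A colouring of S is given by a total function on the edges, whose values
   outside S are unconstrained and irrelevant; the palette is {1, ..., n}. *)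
Definition proper_edge_colouring (G : multigraph) (S : {set edge G}) (n : nat)
    (c : edge G -> nat) : Prop :=
  (forall e, e \in S -> 1 <= c e <= n) /\
  (forall e f, e \in S -> f \in S -> adjacent_edges e f -> c e <> c f).

Definition extends_on (G : multigraph) (S : {set edge G})
    (c0 c : edge G -> nat) : Prop :=
  forall e, e \in S -> c e = c0 e.

(* Main.v *)
Require Import Defs.
From HB Require Import structures.
From mathcomp Require Import all_boot zify.

Set Implicit Arguments.
Unset Strict Implicit.
Unset Printing Implicit Defensive.

(** Delete from the palette, for each edge e = uv outside S, the colours of S
    seen at u or v. If s(x) is the number of edges of S at x, at least
    Delta + k - s(u) - s(v) colours remain, and since s <= k this is at least
    the larger of the degrees of u and v in G - S. So it suffices that a
    bipartite multigraph can be coloured from lists of size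
    |L(uv)| >= max(d(u), d(v)) (Borodin, Kostochka, Woodall).

    By Galvin's argument, repeatedly colouring a stable matching, this holds as
    soon as the edges at each vertex can be linearly ordered so that the
    positions of uv at u and at v add up to less than max(d(u), d(v)). Such
    orders are built by peeling off a nonempty matching M in which every
    neighbour u of a covered v on one fixed side with d(u) >= d(v) is itself
    covered; M is put last on the side of u and first on the side of v. To find
    M, apply Hall's theorem to the edges with d(u) >= d(v): a minimal Hall
    violator F, less one point, is matched onto all of N(F). If there is no
    violator from either side, two saturating matchings force a perfect one. *)

(** * Hall's theorem through minimal edge sets *)

(** A bipartite multigraph is encoded by an edge type [E] with end maps [a] and [b] into its two
    sides, which allows parallel edges; [T] is the set of edges present. *)
Definition matching (E V W : finType) (a : E -> V) (b : E -> W) (M : {set E}) :=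
  {in M &, injective a} /\ {in M &, injective b}.

Definition star (E V : finType) (a : E -> V) (T : {set E}) (x : V) :=
  [set e in T | a e == x].

Definition nbhd (E V W : finType) (a : E -> V) (b : E -> W) (T : {set E})
  (Y : {set W}) := a @: [set e in T | b e \in Y].

Definition hall (E V W : finType) (a : E -> V) (b : E -> W) (T : {set E})
    (X : {set W}) :=
  [forall Y : {set W}, (Y \subset X) ==> (#|Y| <= #|nbhd a b T Y|)].

Lemma mem_nbhd (E V W : finType) (a : E -> V) (b : E -> W) (T : {set E})
  (Y : {set W}) e : e \in T -> b e \in Y -> a e \in nbhd a b T Y.
Proof. by move=> eT eY; apply: imset_f; rewrite inE eT. Qed.

(* Rado: violators obtained by deleting either of two edges at the same vertex
   contradict submodularity of the neighbourhood size. *)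
Lemma hall_minimal_inj (E V W : finType) (a : E -> V) (b : E -> W) T X :
  minset (fun T' => hall a b T' X) T -> {in T &, injective b}.
Proof.
move=> /minsetP [/forallP HT minT] e1 e2 e1T e2T be.
apply/eqP/negPn/negP => ne12.
have viol e : e \in T -> exists Y : {set W}, [/\ Y \subset X, b e \in Y &
    #|nbhd a b (T :\ e) Y| < #|Y|].
  move=> eT; have /forallPn [Y] : ~~ hall a b (T :\ e) X.
    apply/negP => /minT /(_ (subD1set _ _)) eqT.
    by move: eT; rewrite -eqT !inE eqxx.
  rewrite negb_imply -ltnNge => /andP [sYX ltY]; exists Y; split=> //.
  apply/negPn/negP => neY; move: ltY; rewrite ltnNge => /negP; apply.
  have /implyP/(_ sYX)/leq_trans := HT Y; apply; apply: subset_leq_card.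
  apply/subsetP => y /imsetP [f]; rewrite inE => /andP [fT fY] ->.
  apply: mem_nbhd => //; rewrite !inE fT andbT.
  by apply: contraNneq neY => <-.
have [Y1 [sY1 e1Y ltY1]] := viol _ e1T.
have [Y2 [sY2 e2Y ltY2]] := viol _ e2T.
set N1 := nbhd a b (T :\ e1) Y1 in ltY1.
set N2 := nbhd a b (T :\ e2) Y2 in ltY2.
(* The two edges share their [b]-end, so [e1] survives in [T :\ e2] and still contributes to [N2],
   and [e2] to [N1]. *)
have leU : #|Y1 :|: Y2| <= #|N1 :|: N2|.
  have /implyP := HT (Y1 :|: Y2); rewrite subUset sY1 sY2 => /(_ isT)/leq_trans.
  apply; apply/subset_leq_card/subsetP => y /imsetP [f].
  rewrite inE => /andP [fT fY] ->; rewrite inE.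
  case: (eqVneq f e1) => [->|fe1].
    by apply/orP; right; apply: mem_nbhd; rewrite ?be // !inE ne12 e1T.
  case: (eqVneq f e2) => [->|fe2].
    by apply/orP; left; apply: mem_nbhd; rewrite -?be // !inE e2T andbT eq_sym.
  by move: fY; rewrite inE => /orP [fY|fY]; apply/orP; [left|right];
    apply: mem_nbhd; rewrite // !inE fT ?fe1 ?fe2.
(* Dropping the common end [b e1] rules out both deleted edges. *)
have leI : #|(Y1 :&: Y2) :\ b e1| <= #|N1 :&: N2|.
  have /implyP := HT ((Y1 :&: Y2) :\ b e1).
  have -> : (Y1 :&: Y2) :\ b e1 \subset X.
    exact: subset_trans (subD1set _ _) (subset_trans (subsetIl _ _) sY1).
  move=> /(_ isT)/leq_trans; apply.
  apply/subset_leq_card/subsetP => y /imsetP [f].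
  rewrite !inE => /and4P [fT nfe f1 f2] ->; apply/andP; split;
    apply: mem_nbhd => //; rewrite !inE fT andbT.
    by apply: contraNneq nfe => ->.
  by apply: contraNneq nfe => ->; rewrite be.
(* Adding [leU] and [leI] gives |Y1| + |Y2| - 1 <= |N1| + |N2|, whereas the two violations give |N1|
   + |N2| <= |Y1| + |Y2| - 2. *)
have := cardsUI Y1 Y2; have := cardsUI N1 N2.
have := cardsD1 (b e1) (Y1 :&: Y2); rewrite inE e1Y be e2Y -be /=.
lia.
Qed.

(** A minimal edge set satisfying Hall's condition is a matching: edges sharing only their [a]-end
    would give a pair in [X] with a single neighbour. Singletons show that all of [X] is covered. *)
Lemma hall_matching (E V W : finType) (a : E -> V) (b : E -> W) T X :
  hall a b T X ->
  exists M : {set E}, [/\ M \subset T, matching a b M & b @: M = X].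
Proof.
move=> HT.
set TX := [set e in T | b e \in X].
have HTX : hall a b TX X.
  apply/forallP => Y; apply/implyP => sYX.
  have /forallP/(_ Y)/implyP/(_ sYX)/leq_trans := HT; apply.
  apply/subset_leq_card/subsetP => y /imsetP [f]; rewrite inE => /andP [fT fY] ->.
  by apply: mem_nbhd => //; rewrite inE fT (subsetP sYX).
have [M minM sM] := @minset_exists _ (fun T' => hall a b T' X) _ HTX.
have binj := hall_minimal_inj minM.
have /minsetP [/forallP HM _] := minM.
have sbX : forall e, e \in M -> b e \in X.
  by move=> e /(subsetP sM); rewrite inE => /andP [].
exists M; split.
- by apply: subset_trans sM _; apply/subsetP => e; rewrite inE => /andP [].
- split=> // e f eM fM ae; apply/eqP/negPn/negP => nef.
  have nb : b e != b f by apply: contraNneq nef => /binj ->.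
  have /implyP := HM [set b e; b f].
  have -> : [set b e; b f] \subset X by rewrite subUset !sub1set !sbX.
  move=> /(_ isT); rewrite cards2 nb leqNgt => /negP; apply.
  rewrite ltnS /= -(cards1 (a e)); apply/subset_leq_card/subsetP => y /imsetP [g].
  rewrite !inE => /andP [gM /orP [] /eqP /binj -> //] -> //.
  by rewrite ae.
apply/eqP; rewrite eqEsubset; apply/andP; split.
  by apply/subsetP => _ /imsetP [e eM ->]; apply: sbX.
apply/subsetP => x xX; have /implyP := HM [set x].
rewrite sub1set xX cards1 => /(_ isT) /card_gt0P [y /imsetP [e]].
by rewrite !inE => /andP [eM /eqP <-] _; apply: imset_f.
Qed.

(** * Peelable matchings *)

Definition peelable (E V W : finType) (a : E -> V) (b : E -> W)
    (T M : {set E}) :=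
  [/\ M \subset T, M != set0, matching a b M & forall e, e \in T ->
    b e \in b @: M -> #|star b T (b e)| <= #|star a T (a e)| ->
    a e \in a @: M].

Lemma peelable_or_saturating (E V W : finType) (a : E -> V) (b : E -> W) T :
  (exists M, peelable a b T M) \/
  (exists M : {set E}, [/\ M \subset T, matching a b M & b @: M = b @: T]).
Proof.
set T1 := [set e in T | #|star b T (b e)| <= #|star a T (a e)|].
have sT1 : T1 \subset T by apply/subsetP => e; rewrite inE => /andP [].
case: (boolP (hall a b T1 (b @: T))) => [/hall_matching [M [sM mM bM]]|].
  by right; exists M; split=> //; apply: subset_trans sT1.
case/forallPn => F0; rewrite negb_imply -ltnNge => HF0; left.
pose P (F : {set W}) := (F \subset b @: T) && (#|nbhd a b T1 F| < #|F|).
have [F /minsetP [/andP [sF ltF] minF] _] := @minset_exists _ P F0 HF0.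
have /card_gt0P [x xF] : 0 < #|F| by apply: leq_ltn_trans ltF.
have HF : hall a b T1 (F :\ x).
  apply/forallP => Y; apply/implyP => sY; rewrite leqNgt; apply/negP => ltY.
  have sYF : Y \subset F := subset_trans sY (subD1set _ _).
  have eYF : Y = F by apply: minF => //; rewrite /P ltY (subset_trans sYF).
  by move: (subsetP sY x); rewrite eYF xF !inE eqxx => /(_ isT).
have [M [sM [ainj binj] bM]] := hall_matching HF.
(* [M] has |F| - 1 >= |N(F)| edges with distinct [a]-ends, all in N(F). *)
have aM : a @: M = nbhd a b T1 F.
  apply/eqP; rewrite eqEcard; apply/andP; split.
    apply/subsetP => _ /imsetP [e eM ->]; apply: mem_nbhd.
      exact: (subsetP sM).
    have : b e \in F :\ x by rewrite -bM imset_f.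
    by rewrite inE => /andP [].
  rewrite card_in_imset // -(card_in_imset binj) bM.
  by move: ltF; rewrite (cardsD1 x F) xF.
case: (set_0Vmem M) => [M0|[e0 e0M]]; last first.
  exists M; split=> //; first exact: subset_trans sT1.
    by apply/set0Pn; exists e0.
  move=> e eT; rewrite bM => /setD1P [_ eF] le.
  by rewrite aM; apply: mem_nbhd; rewrite // inE eT.
(* Now F = {x} and N(F) is empty: no edge of [T1] ends at [x], so any single edge of [T] at [x] is
   peelable, its condition being vacuous. *)
have /imsetP [e0 e0T xe0] := subsetP sF x xF.
exists [set e0]; split; rewrite ?sub1set //.
- by apply/set0Pn; exists e0; rewrite inE.
- by split=> e f /set1P -> /set1P ->.
move=> e eT; rewrite imset_set1 => /set1P be le.
have : a e \in nbhd a b T1 F.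
  by apply: mem_nbhd; rewrite ?inE ?eT // be -xe0.
by rewrite -aM M0 imset0 inE.
Qed.

Lemma exists_peelable (E V W : finType) (a : E -> V) (b : E -> W) (T : {set E}) :
  T != set0 -> exists M, peelable a b T M \/ peelable b a T M.
Proof.
move=> T0.
case: (peelable_or_saturating a b T) => [[M HM]|[M [sM [ainj binj] bM]]].
  by exists M; left.
case: (peelable_or_saturating b a T) => [[M' HM]|[M' [sM' [binj' ainj'] aM]]].
  by exists M'; right.
exists M; left; split=> //.
  apply: contraNneq T0 => M0; apply/eqP/setP => e; rewrite inE.
  apply/negP => eT; have : b e \in b @: M by rewrite bM imset_f.
  by rewrite M0 imset0 inE.
(* Counting: |a(T)| = |M'| = |b(M')| <= |b(T)| = |M| = |a(M)|. *)
move=> e eT _ _; suff -> : a @: M = a @: T by apply: imset_f.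
apply/eqP; rewrite eqEcard imsetS //= -aM !card_in_imset //.
by rewrite -(card_in_imset binj) bM -(card_in_imset binj') subset_leq_card ?imsetS.
Qed.

(** * Edge orders with small rank sums *)

Lemma card_star_matching (E V : finType) (a : E -> V) (T M : {set E}) x :
  M \subset T -> {in M &, injective a} ->
  #|star a T x| = #|star a (T :\: M) x| + (x \in a @: M).
Proof.
move=> sM ainj; rewrite -(cardsID M (star a T x)) addnC; congr (_ + _).
  by apply: eq_card => e; rewrite !inE andbA.
case: imsetP => [[e eM xe]|ne].
  rewrite /= -(cards1 e); apply: eq_card => f; rewrite !inE.
  apply/andP/eqP => [[/andP [_ /eqP fx] fM]|->].
    by apply: ainj; rewrite // fx.
  by rewrite (subsetP sM) // xe eqxx.
apply/eqP; rewrite cards_eq0; apply/eqP/setP => f; rewrite !inE.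
by apply/negP => /andP [/andP [_ /eqP fx] fM]; apply: ne; exists f.
Qed.

(* Position 0 is the most preferred edge at a vertex. *)
Definition ranks_at (E V : finType) (a : E -> V) (T : {set E}) (r : E -> nat) :=
  {in T, forall e, r e < #|star a T (a e)|} /\
  {in T &, forall e f, a e = a f -> r e = r f -> e = f}.

Definition good_ranks (E V W : finType) (a : E -> V) (b : E -> W) (T : {set E})
    (ra rb : E -> nat) :=
  [/\ ranks_at a T ra, ranks_at b T rb & {in T, forall e,
    ra e + rb e < maxn #|star a T (a e)| #|star b T (b e)|}].

Lemma good_ranks_sym (E V W : finType) (a : E -> V) (b : E -> W) T ra rb :
  good_ranks a b T ra rb -> good_ranks b a T rb ra.
Proof. by move=> [? ? H]; split=> // e eT; rewrite addnC maxnC H. Qed.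

(* The edges of the peeled matching come last at their a-end and first at their
   b-end. *)
Lemma good_ranks_peel (E V W : finType) (a : E -> V) (b : E -> W)
    (T M : {set E}) ra rb :
  peelable a b T M -> good_ranks a b (T :\: M) ra rb ->
  exists ra' rb', good_ranks a b T ra' rb'.
Proof.
move=> [sM _ [ainj binj] HM] [[ralt rainj] [rblt rbinj] rab].
exists (fun e => if e \in M then #|star a T (a e)|.-1 else ra e).
exists (fun e => if e \in M then 0 else rb e + (b e \in b @: M)).
have TM e : e \in T -> e \notin M -> e \in T :\: M by move=> *; apply/setDP.
have a0 e : e \in T -> 0 < #|star a T (a e)|.
  by move=> eT; apply/card_gt0P; exists e; rewrite !inE eT eqxx.
have b0 e : e \in T -> 0 < #|star b T (b e)|.
  by move=> eT; apply/card_gt0P; exists e; rewrite !inE eT eqxx.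
have da := card_star_matching _ sM ainj.
have db := card_star_matching _ sM binj.
split; first split.
- move=> e eT /=; case: ifP => eM; first by rewrite prednK // a0.
  by rewrite da; apply: leq_trans (ralt _ (TM _ eT (negbT eM))) (leq_addr _ _).
- move=> e f eT fT aef.
  case: ifPn => eM; case: ifPn => fM.
  + by move=> _; apply: ainj.
  + rewrite da imset_f // aef addn1 /= => rf.
    by have := ralt _ (TM _ fT fM); rewrite rf ltnn.
  + rewrite da imset_f // addn1 /= => rf.
    by have := ralt _ (TM _ eT eM); rewrite rf aef ltnn.
  + by apply: rainj; rewrite ?TM.
- split=> [e eT|e f eT fT bef] /=.
    case: ifPn => eM; first exact: b0.
    by rewrite db ltn_add2r rblt ?TM.
  case: ifPn => eM; case: ifPn => fM.
  + by move=> _; apply: binj.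
  + by rewrite -bef imset_f // addn1.
  + by rewrite bef imset_f // addn1.
  + by rewrite bef => /addIn; apply: rbinj; rewrite ?TM.
move=> e eT /=; case: ifPn => eM; first by have := a0 e eT; lia.
(* The rank sum of [e] grows only if [M] covers [b e], and then by one. If [a e] is covered too,
   both degrees grow; otherwise [HM] makes the degree at [b e] strictly larger, so the maximum still
   grows by one. *)
have := rab _ (TM _ eT eM); have := HM e eT; rewrite !da !db.
by case: (b e \in _); case: (a e \in _) => //=; lia.
Qed.

Lemma exists_good_ranks (E V W : finType) (a : E -> V) (b : E -> W)
    (T : {set E}) : exists ra rb, good_ranks a b T ra rb.
Proof.
have [n leT] := ubnP #|T|; elim: n T leT => // n IHn T leT.
case: (eqVneq T set0) => [->|T0].
  exists (fun=> 0), (fun=> 0).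
  by split; [split|split|] => e => [|f||f|]; rewrite inE.
have smaller (M : {set E}) : M \subset T -> M != set0 -> #|T :\: M| < n.
  move=> sM; rewrite -card_gt0 => M0; rewrite cardsDS //.
  by have := subset_leq_card sM; lia.
have [M [pM|pM]] := exists_peelable a b T0; have [sM M0 _ _] := pM;
  have [ra [rb Hr]] := IHn _ (smaller M sM M0).
  exact: good_ranks_peel pM Hr.
have [rb' [ra' Hr']] := good_ranks_peel pM (good_ranks_sym Hr).
by exists ra', rb'; apply: good_ranks_sym.
Qed.

(** * Stable matchings and list colouring *)

Definition better (E V : finType) (a : E -> V) (r : E -> nat) (f e : E) :=
  (a f == a e) && (r f < r e).

(** Gale-Shapley by deletion. If two favourites of [a]-vertices meet at a [b]-vertex, the worse one
    is deleted: whatever beats the better one must do so at that [b]-vertex, hence beats both.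
    Without such a clash the favourites form the matching. *)
Lemma stable_matching (E V W : finType) (a : E -> V) (b : E -> W)
    (ra rb : E -> nat) (T : {set E}) :
  {in T &, forall e f, a e = a f -> ra e = ra f -> e = f} ->
  {in T &, forall e f, b e = b f -> rb e = rb f -> e = f} ->
  exists M : {set E}, [/\ M \subset T, matching a b M &
    forall e, e \in T -> e \notin M ->
      exists2 f, f \in M & better a ra f e || better b rb f e].
Proof.
have [n leT] := ubnP #|T|; elim: n T leT => // n IHn T leT rainj rbinj.
pose best := [set e in T | [forall f in T, ~~ better a ra f e]].
have sbT : best \subset T by apply/subsetP => e; rewrite inE => /andP [].
have abest : {in best &, injective a}.
  move=> e f; rewrite !inE => /andP [eT /forall_inP He] /andP [fT /forall_inP Hf].
  move=> aef; apply: rainj => //.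
  have := He f fT; have := Hf e eT; rewrite /better aef eqxx /=.
  by case: ltngtP.
have [/existsP [e /existsP [f]]|nex] := boolP [exists e, exists f,
    [&& e \in best, f \in best & better b rb f e]].
  case/and3P => ebest fbest fe.
  have eT := subsetP sbT _ ebest; have fT := subsetP sbT _ fbest.
  have sD : {subset T :\ e <= T} by apply/subsetP/subD1set.
  have [|||M [sM mM HM]] := IHn (T :\ e).
  - by move: leT; rewrite (cardsD1 e) eT.
  - by move=> x y /sD xT /sD yT; apply: rainj.
  - by move=> x y /sD xT /sD yT; apply: rbinj.
  exists M; split=> // [|g gT gM]; first exact: subset_trans sM (subD1set _ _).
  have [ge|ge] := eqVneq g e; last by apply: HM; rewrite // !inE ge.
  subst g; have nfe : f != e by apply: contraTneq fe => ->; rewrite /better ltnn andbF.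
  have [fM|fM] := boolP (f \in M); first by exists f; rewrite ?fe ?orbT.
  have [|h hM] := HM f _ fM; first by rewrite !inE nfe.
  have hT := sD _ (subsetP sM _ hM).
  move: fbest; rewrite inE fT => /forall_inP/(_ h hT)/negbTE -> /= hf.
  exists h => //; apply/orP; right; move: hf fe; rewrite /better.
  by move=> /andP [/eqP -> h1] /andP [-> h2]; apply: ltn_trans h1 h2.
exists best; split=> //.
  split=> // e f eb fb bef; apply: rbinj; rewrite ?(subsetP sbT) //.
  have [lt|lt|//] := ltngtP (rb e) (rb f); case/negP: nex; apply/existsP;
    [exists f|exists e]; apply/existsP; [exists e|exists f];
    by rewrite eb fb /better bef eqxx.
move=> e eT eb; pose P := [pred f | (f \in T) && (a f == a e)].
have Pe : P e by rewrite /= eT eqxx.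
case: (arg_minnP ra Pe) => f /andP [fT /eqP aef] minf.
have fb : f \in best.
  rewrite inE fT; apply/forall_inP => g gT; rewrite /better aef.
  by apply/negP => /andP [ag]; rewrite ltnNge minf //= gT.
exists f => //.
have nfe : f <> e.
  by move=> fe; move: eb; rewrite -fe fb.
rewrite /better aef eqxx /= ltn_neqAle minf // andbT; apply/orP; left.
by apply/eqP => /(rainj _ _ fT eT aef).
Qed.

(** Galvin's induction: a stable matching among the edges whose lists contain [x] receives colour
    [x]. Every other edge that loses [x] also loses an edge beating it, so the strict inequality
    survives. *)
Lemma colouring_of_preferences (E V W C : finType) (a : E -> V) (b : E -> W)
    (ra rb : E -> nat) (c0 : C) (T : {set E}) (L : E -> {set C}) :
  {in T &, forall e f, a e = a f -> ra e = ra f -> e = f} ->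
  {in T &, forall e f, b e = b f -> rb e = rb f -> e = f} ->
  {in T, forall e, #|[set f in T | better a ra f e]|
                 + #|[set f in T | better b rb f e]| < #|L e|} ->
  exists2 c : E -> C, {in T, forall e, c e \in L e} &
    {in T &, forall e f, a e = a f \/ b e = b f -> c e = c f -> e = f}.
Proof.
have [n leT] := ubnP #|T|; elim: n T L leT => // n IHn T L leT rainj rbinj HL.
have [T0|[e0 e0T]] := set_0Vmem T.
  by exists (fun=> c0) => e => [|f]; rewrite T0 inE.
have /card_gt0P [x xL] : 0 < #|L e0| by apply: leq_ltn_trans (HL _ e0T).
pose Tx := [set e in T | x \in L e].
have sTx : {subset Tx <= T} by move=> e; rewrite inE => /andP [].
have [||M [sM [ainj binj] HM]] := @stable_matching _ _ _ a b ra rb Tx.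
- by move=> e f /sTx eT /sTx fT; apply: rainj.
- by move=> e f /sTx eT /sTx fT; apply: rbinj.
have e0x : e0 \in Tx by rewrite inE e0T.
have sMT : M \subset T by apply/subsetP => e /(subsetP sM)/sTx.
(* The induction needs [T] to shrink: [e0] is in [M] or is beaten by an edge of [M]. *)
have M0 : 0 < #|M|.
  have [e0M|/(HM _ e0x) [f fM _]] := boolP (e0 \in M); apply/card_gt0P.
    by exists e0.
  by exists f.
have sD : {subset T :\: M <= T} by apply/subsetP/subsetDl.
have [||||c cL cP] := IHn (T :\: M) (fun e => L e :\ x).
- by rewrite cardsDS //; have := subset_leq_card sMT; lia.
- by move=> e f /sD eT /sD fT; apply: rainj.
- by move=> e f /sD eT /sD fT; apply: rbinj.
- move=> e /setDP [eT eM].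
  have sub (p : pred E) : [set f in T :\: M | p f] \subset [set f in T | p f].
    by apply/subsetP => f; rewrite !inE => /andP [/andP [_ ->]].
  have sub_lt (p : pred E) g : g \in M -> p g ->
      #|[set f in T :\: M | p f]| < #|[set f in T | p f]|.
    move=> gM pg; apply: proper_card; apply/properP; split=> //.
    by exists g; rewrite !inE ?gM // pg (subsetP sMT).
  have := HL e eT; rewrite (cardsD1 x (L e)).
  have := subset_leq_card (sub (fun f => better a ra f e)).
  have := subset_leq_card (sub (fun f => better b rb f e)).
  have [xe|xe] := boolP (x \in L e); last by lia.
  have [|g gM /orP [pg|pg]] := HM e _ eM; first by rewrite inE eT.
    by have := sub_lt (fun f => better a ra f e) g gM pg; lia.
  by have := sub_lt (fun f => better b rb f e) g gM pg; lia.
have cx e : e \in T -> e \notin M -> c e != x.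
  by move=> eT eM; have /cL := introT setDP (conj eT eM) => /setD1P [].
exists (fun e => if e \in M then x else c e) => [e eT|e f eT fT ab] /=.
  case: ifPn => eM; first by have /(subsetP sM) := eM; rewrite inE eT.
  by have /cL := introT setDP (conj eT eM) => /setD1P [].
case: ifPn => eM; case: ifPn => fM.
- by case: ab => [/ainj|/binj] ->.
- by move=> xf; have := cx f fT fM; rewrite -xf eqxx.
- by move=> xe; have := cx e eT eM; rewrite xe eqxx.
- by apply: cP => //; apply/setDP.
Qed.

(** The edges beating [e] have distinct ranks below [r e]. *)
Lemma card_better_leq (E V : finType) (a : E -> V) (r : E -> nat) (T : {set E}) e :
  {in T &, forall e f, a e = a f -> r e = r f -> e = f} ->
  #|[set f in T | better a r f e]| <= r e.
Proof.
move=> rinj; have [x0|[x xB]] := set_0Vmem [set f in T | better a r f e].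
  by rewrite x0 cards0.
rewrite -[leqRHS]card_ord.
have re0 : 0 < r e by move: xB; rewrite inE => /andP [_ /andP [_]]; lia.
rewrite -(prednK re0).
rewrite -(@card_in_imset _ _ (fun f => inord (r f) : 'I_(r e).-1.+1)).
  exact: max_card.
move=> f g; rewrite !inE => /andP [fT /andP [/eqP af rf]].
move=> /andP [gT /andP [/eqP ag rg]] /(congr1 val).
by rewrite /= !inordK ?prednK // => rfg; apply: rinj; rewrite // af ag.
Qed.

Theorem bipartite_list_edge_colouring (E V W C : finType) (a : E -> V)
    (b : E -> W) (c0 : C) (T : {set E}) (L : E -> {set C}) :
  {in T, forall e, maxn #|star a T (a e)| #|star b T (b e)| <= #|L e|} ->
  exists2 c : E -> C, {in T, forall e, c e \in L e} &
    {in T &, forall e f, a e = a f \/ b e = b f -> c e = c f -> e = f}.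
Proof.
move=> HL; have [ra [rb [[_ rainj] [_ rbinj] rab]]] := exists_good_ranks a b T.
apply: (colouring_of_preferences c0 rainj rbinj) => e eT.
apply: leq_ltn_trans (leq_trans (rab e eT) (HL e eT)).
by rewrite leq_add ?card_better_leq.
Qed.

(** * Extending the precolouring *)

Theorem theorem2p1 (G : multigraph) (k : nat) (S : {set edge G})
    (c0 : edge G -> nat) :
  bipartite G ->
  1 <= k ->
  proper_edge_colouring S (max_degree G + k) c0 ->
  (forall v : vertex G, #|incident_edges v :&: S| <= k) ->
  exists c : edge G -> nat,
    proper_edge_colouring [set: edge G] (max_degree G + k) c /\
    extends_on S c0 c.
Proof.
move=> [A HA] _ [c0n c0P] Sk; set n := max_degree G + k.
have exa e : exists x, ends e :&: A == [set x].
  by have [/eqP/cards1P [x ->] _] := HA e; exists x.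
have exb e : exists x, ends e :&: ~: A == [set x].
  by have [_ /eqP/cards1P [x ->]] := HA e; exists x.
(* The ends of [e] inside and outside [A]. *)
pose a e := xchoose (exa e); pose b e := xchoose (exb e).
have aE e : ends e :&: A = [set a e] by apply/eqP/(xchooseP (exa e)).
have bE e : ends e :&: ~: A = [set b e] by apply/eqP/(xchooseP (exb e)).
have mem_ends e v : (v \in ends e) = if v \in A then v == a e else v == b e.
  have := congr1 (fun X : {set _} => v \in X) (aE e).
  have := congr1 (fun X : {set _} => v \in X) (bE e).
  by rewrite !inE; case: (v \in A); rewrite ?andbT ?andbF.
have aA e : a e \in A by have := set11 (a e); rewrite -aE inE => /andP [].
have bA e : b e \notin A by have := set11 (b e); rewrite -bE !inE => /andP [].
have a_ends e : a e \in ends e by rewrite mem_ends aA.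
have b_ends e : b e \in ends e by rewrite mem_ends (negbTE (bA e)).
have adjP e f v : v \in ends e -> v \in ends f -> a e = a f \/ b e = b f.
  by rewrite !mem_ends; case: ifP => _ /eqP <- /eqP <-; [left|right].
(* Colours live in ['I_n.+1]; [L] excludes 0, leaving exactly the palette 1, ..., n before the used
   colours are removed. *)
pose used v := [set (inord (c0 f) : 'I_n.+1) | f in incident_edges v :&: S].
pose L e := [set i : 'I_n.+1 | 0 < i] :\: (used (a e) :|: used (b e)).
have used_le v : #|used v| <= #|incident_edges v :&: S| by apply: leq_imset_card.
have card_L e : n <= #|L e| + #|used (a e)| + #|used (b e)|.
  have : n <= #|[set i : 'I_n.+1 | 0 < i]|.
    have -> : [set i : 'I_n.+1 | 0 < i] = [set~ ord0].
      by apply/setP => i; rewrite !inE lt0n.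
    by rewrite cardsC1 card_ord.
  have := cardsD [set i : 'I_n.+1 | 0 < i] (used (a e) :|: used (b e)).
  rewrite -/(L e).
  have := subset_leq_card (subsetIr [set i : 'I_n.+1 | 0 < i]
    (used (a e) :|: used (b e))).
  have := cardsU (used (a e)) (used (b e)); lia.
have deg v : #|incident_edges v :&: S| + #|incident_edges v :\: S| <= max_degree G.
  by rewrite cardsID; apply: (leq_bigmax v).
have star_le (h : edge G -> vertex G) v : (forall e, h e \in ends e) ->
    #|star h (~: S) v| <= #|incident_edges v :\: S|.
  move=> hP; apply/subset_leq_card/subsetP => f.
  by rewrite !inE => /andP [-> /eqP <-]; rewrite hP.
have [|c cL cP] := @bipartite_list_edge_colouring _ _ _ _ a b (ord0 : 'I_n.+1) (~: S) L.
  move=> e _.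
  have := card_L e; have := deg (a e); have := deg (b e).
  have := Sk (a e); have := Sk (b e).
  have := used_le (a e); have := used_le (b e).
  have := star_le a (a e) a_ends; have := star_le b (b e) b_ends.
  rewrite /n; lia.
(* The colour of an edge of [S] at an end of [f] is in [used] there, so it is absent from [L f]. *)
have cross e f v : e \in S -> f \notin S -> v \in ends e -> v \in ends f ->
    c0 e <> c f :> nat.
  move=> eS fS ve vf ef.
  have vab : v = a f \/ v = b f.
    by move: vf; rewrite mem_ends; case: ifP => _ /eqP; [left|right].
  have cu : c f \in used v.
    apply/imsetP; exists e; first by rewrite !inE ve.
    by apply: val_inj; rewrite /= inordK ef.
  have : c f \in L f by apply: cL; rewrite inE.
  by case: vab cu => -> cu; rewrite !inE cu ?orbT.
exists (fun e => if e \in S then c0 e else c e); split; last by move=> e /= ->.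
split=> [e _|e f _ _ [nef [v [ve vf]]]] /=.
  case: ifPn => eS; first exact: c0n.
  have : c e \in L e by apply: cL; rewrite inE.
  by case/setDP; rewrite inE => -> _; rewrite -ltnS ltn_ord.
case: ifPn => eS; case: ifPn => fS.
- by apply: c0P => //; split=> //; exists v.
- exact: cross ve vf.
- by move/esym; apply: cross vf ve.
- move=> /val_inj cef; apply: nef; apply: cP; rewrite ?inE //.
  exact: adjP ve vf.
Qed.
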